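(* Let $H$ be a finite simple connected graph with a proper labeling $f$ and edge densities $\gamma_e\in[0,1]$ ($e\in E(H)$), and let $T_f(H)$ be its weighted monotone-path tree, whose edges carry the induced weights. Assume that these weights, taken as edge densities on $T_f(H)$, do not ensure the existence of the factor $T_f(H)$. Then there is a weighted blow-up graph of $H$ that does not contain $H$ as a transversal and in which, for every edge $uv\in E(H)$, the density between the clusters of $u$ and $v$ is at least $\gamma_{uv}$.
   Context: A proper labeling of a graph $H$ on $n$ vertices is a bijection $f:\{1,\dots,n\}\to V(H)$ such that $\{f(1),\dots,f(k)\}$ induces a connected subgraph of $H$ for all $1\le k\le n$. Given $H$ with edge weights in $[0,1]$ and a proper labeling $f$, the weighted monotone-path tree $T_f(H)$ has as vertices the paths $f(i_1)f(i_2)\cdots f(i_k)$ of $H$ ($k\ge1$) with $1=i_1<i_2<\dots<i_k$; two such paths are adjacent if one is the extension of the other by exactly one new (last) vertex; the weight of the edge joining $f(i_1)\cdots f(i_{k-1})$ and $f(i_1)\cdots f(i_k)$ is the weight of the edge $f(i_{k-1})f(i_k)$ of $H$. A weighted blow-up graph $G[K]$ of a graph $K$ is a graph whose vertex set is the disjoint union of finite nonempty clusters $A_v$ ($v\in V(K)$), whose edges only join vertices of $A_u$ to vertices of $A_v$ with $uv\in E(K)$ (not necessarily all such pairs), together with non-negative vertex weights $w$ such that the total weight of each cluster is $1$. For $uv\in E(K)$ the density is $d(A_u,A_v)=\sum w(x)w(y)$, the sum running over all edges $xy$ of $G[K]$ with $x\in A_u$, $y\in A_v$. $G[K]$ contains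 $K$ as a transversal (factor) if one can choose $\varphi(v)\in A_v$ for every $v\in V(K)$ such that $\varphi(u)\varphi(v)\in E(G[K])$ for every $uv\in E(K)$. Numbers $(\gamma_e)_{e\in E(K)}$ ensure the existence of the factor $K$ if every weighted blow-up graph of $K$ with $d(A_u,A_v)\ge\gamma_{uv}$ for all $uv\in E(K)$ contains $K$ as a transversal. *)

(* Defs.v *)
From mathcomp Require Import all_boot all_order all_algebra.
From mathcomp Require Import reals.
Set Implicit Arguments.
Unset Strict Implicit.
Unset Printing Implicit Defensive.
Import Order.TTheory GRing.Theory Num.Theory.
Local Open Scope ring_scope.

(** A finite simple graph is a symmetric irreflexive [e : rel V] on a
    [V : finType].  An assignment of numbers to its edges is a function
    [V -> V -> R], of which only the values on edges matter, and which is
    required to be symmetric there. *)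

Definition connected_in (V : finType) (e : rel V) (A : {set V}) : Prop :=
  A != set0 /\
  {in A &, forall x y,
    connect [rel a b | [&& a \in A, b \in A & e a b]] x y}.

Definition connected_graph (V : finType) (e : rel V) : Prop :=
  connected_in e [set: V].

(** Labels are numbered from 0: the ordinal of value [k] plays the role of the
    label [k + 1].  A connected graph is nonempty, so its number of
    vertices has the form [n.+1]. *)
Definition proper_labeling (V : finType) (e : rel V) (n : nat)
    (f : 'I_n.+1 -> V) : Prop :=
  bijective f /\
  forall k : nat, (0 < k <= n.+1)%N ->
    connected_in e [set f i | i : 'I_n.+1 & (i < k)%N].

Section MonotonePathTree.
Variables (R : realType) (V : finType) (e : rel V) (n : nat) (f : 'I_n.+1 -> V).

(** The path [f i_1, ..., f i_k] is stored as the sequence of its labels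
    [i_1, ..., i_k]. *)
Definition monotone_path (s : seq 'I_n.+1) : bool :=
  [&& ohead s == Some ord0,
      sorted [rel i j : 'I_n.+1 | (i < j)%N] s
    & sorted e (map f s)].

(** Strictly increasing sequences of labels have size at most [n.+1], so the
    bound on the size, needed to get a finite type, excludes nothing. *)
Definition mpath : finType := {s : (n.+1).-bseq 'I_n.+1 | monotone_path s}.

Definition mpath_seq (p : mpath) : seq 'I_n.+1 := val (val p).

(** The default value [ord0] is never used: monotone paths are nonempty. *)
Definition mpath_end (p : mpath) : V := f (last ord0 (mpath_seq p)).

Definition mpath_extends (p q : mpath) : bool :=
  [exists i, mpath_seq q == rcons (mpath_seq p) i].

Definition mtree_adj : rel mpath :=
  [rel p q | mpath_extends p q || mpath_extends q p].

Definition mtree_weight (gamma : V -> V -> R) (p q : mpath) : R :=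
  gamma (mpath_end p) (mpath_end q).

End MonotonePathTree.

(** The cluster of [v] is the fibre of [bl_cluster] over [v]. *)
Record blowup (R : realType) (K : finType) (eK : rel K) := Blowup {
  bl_vertex : finType;
  bl_cluster : bl_vertex -> K;
  bl_adj : rel bl_vertex;
  bl_weight : bl_vertex -> R;
  bl_nonempty : forall v, exists x, bl_cluster x = v;
  bl_adj_sym : symmetric bl_adj;
  bl_adj_cluster : forall x y, bl_adj x y -> eK (bl_cluster x) (bl_cluster y);
  bl_weight_ge0 : forall x, 0 <= bl_weight x;
  bl_weight_cluster : forall v, \sum_(x | bl_cluster x == v) bl_weight x = 1
}.

Arguments bl_cluster {R K eK} G x : rename.
Arguments bl_adj {R K eK} G x y : rename.
Arguments bl_weight {R K eK} G x : rename.

Section Blowup.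
Variables (R : realType) (K : finType) (eK : rel K).

Definition density (G : blowup R eK) (u v : K) : R :=
  \sum_(x | bl_cluster G x == u)
    \sum_(y | (bl_cluster G y == v) && bl_adj G x y) bl_weight G x * bl_weight G y.

Definition has_densities (gamma : K -> K -> R) (G : blowup R eK) : Prop :=
  forall u v, eK u v -> gamma u v <= density G u v.

Definition has_transversal (G : blowup R eK) : Prop :=
  exists phi : K -> bl_vertex G,
    (forall v, bl_cluster G (phi v) = v) /\
    (forall u v, eK u v -> bl_adj G (phi u) (phi v)).

Definition ensures_factor (gamma : K -> K -> R) : Prop :=
  forall G : blowup R eK, has_densities gamma G -> has_transversal G.

End Blowup.

Arguments has_densities {R K} eK gamma G.
Arguments has_transversal {R K} eK G.
Arguments ensures_factor {R K} eK gamma.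

(* Main.v *)
Require Import Defs.
From mathcomp Require Import all_boot all_order all_algebra.
From mathcomp Require Import reals.
From mathcomp Require Import lra.
Set Implicit Arguments.
Unset Strict Implicit.
Unset Printing Implicit Defensive.
Import Order.TTheory GRing.Theory Num.Theory.
Local Open Scope ring_scope.

(** The subtree of the monotone-path tree above a path [p] consists of the
    increasing paths that start at the end of [p], so it depends on that end
    alone.  Peeling leaves off the tree therefore amounts to a recursion on the
    vertices of the graph, run from the last label down to the first:
    [g u = 1 - \sum_w (1 - gamma u w) / g w], where [w] ranges over the
    neighbours of [u] with a larger label.

    If all the [g u] are positive, then in every weighted blow-up of the tree
    with the prescribed densities the vertices of the cluster of [p] from which
    the subtree above [p] can be embedded have total weight at least
    [g (mpath_end p)] ([extendable_weight_ge]).  Indeed, a vertex [x] fails only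
    if for some child [q] of [p] it is adjacent to no extendable vertex of the
    cluster of [q].  Such vertices [x] and the extendable vertices of [q] span
    no edge, so the product of their weights is at most [1 - gamma], which
    bounds the weight of these [x] by the term of [q] in the recursion.
    Extendable vertices can then be chosen along the tree, and the densities
    ensure the tree ([tree_has_transversal]).

    So the hypothesis yields a vertex with [g v <= 0]; take the one with the
    largest label.  The losses counted by the recursion can then all be realised
    in one blow-up of the graph itself ([blowup_of_nonpositive]).  The cluster of [u] has one free vertex and, for
    each later neighbour [w], one vertex that blocks [w]: its only non-neighbour
    in the cluster of [w] is the free vertex of [w].  In a transversal, the
    vertex with the largest label at which a blocking vertex is chosen would
    block a free vertex, so only free vertices are chosen.  With
    [(1 - gamma u w) / g w] as the weight of the vertex of [u] that blocks [w],
    and hence [g u] as that of the free vertex, the density missing between [u]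
    and [w] is exactly [1 - gamma u w].  At [v] the blocking vertices have total
    weight at least 1; scaled down to total weight 1, they leave no room for a
    free vertex, and no transversal exists.  The clusters of smaller labels carry
    all their weight on the free vertex. *)

(** * Recursion along a rank *)

(** The weights [g], the extendable vertices and the transversal of the tree
    are all defined by recursion along a numbering, each value depending on
    those already reached; this turns such a recursion into a fixpoint
    equation. *)
Lemma ranked_recursion (T A : Type) (r : T -> nat) (F : (T -> A) -> T -> A)
    (a0 : A) :
  (forall g h x, (forall y, (r y < r x)%N -> g y = h y) -> F g x = F h x) ->
  exists g : T -> A, forall x, g x = F g x.
Proof.
move=> F_local; pose G k := iter k F (fun=> a0).
have stable k m x : (r x < k)%N -> (r x < m)%N -> G k x = G m x.
  elim: k m x => [|k IHk] [|m] x //; rewrite !ltnS => ltxk ltxm.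
  by apply: F_local => y ltyx; apply: IHk; apply: leq_trans ltyx _.
exists (fun x => G (r x).+1 x) => x.
by apply: F_local => y ltyx; apply: stable.
Qed.

(** * Densities in a blow-up *)

Section BlowupDensity.
Variables (R : realType) (K : finType) (eK : rel K) (G : blowup R eK).

Lemma density_complement u v :
  density G u v
    + \sum_(x | bl_cluster G x == u)
        \sum_(y | (bl_cluster G y == v) && ~~ bl_adj G x y)
          bl_weight G x * bl_weight G y = 1.
Proof.
rewrite /density -big_split /= -[RHS](bl_weight_cluster G u).
apply: eq_bigr => x _; rewrite -[RHS]mulr1 -(bl_weight_cluster G v) mulr_sumr.
by rewrite [RHS](bigID (bl_adj G x)).
Qed.

Lemma density_sym u v : density G u v = density G v u.
Proof.
rewrite /density (exchange_big_dep (fun y => bl_cluster G y == v)) /=; last first.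
  by move=> x y _ /andP[].
apply: eq_bigr => y yv; apply: eq_big => [x|x _]; last exact: mulrC.
by rewrite yv bl_adj_sym.
Qed.

Lemma independent_weight_le u v (P Q : pred (bl_vertex G)) :
  (forall x y, P x -> Q y -> bl_cluster G x = u -> bl_cluster G y = v ->
     ~~ bl_adj G x y) ->
  (\sum_(x | (bl_cluster G x == u) && P x) bl_weight G x)
    * (\sum_(y | (bl_cluster G y == v) && Q y) bl_weight G y)
  <= 1 - density G u v.
Proof.
move=> PQ; rewrite -(density_complement u v) addrAC subrr add0r.
rewrite mulr_suml big_mkcondr /=; apply: ler_sum => x /eqP xu.
have w0 y : 0 <= bl_weight G x * bl_weight G y.
  by rewrite mulr_ge0 // bl_weight_ge0.
case: ifP => [Px|_]; last by apply: sumr_ge0.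
rewrite mulr_sumr big_mkcondr /= [leRHS]big_mkcondr /=.
apply: ler_sum => y /eqP yv.
case: ifP => [Qy|_]; last by case: ifP.
by rewrite PQ.
Qed.

End BlowupDensity.

(** * The blocking blow-up *)

Section Construction.
Variables (R : realType) (V : finType) (e : rel V) (l : V -> nat).
Hypotheses (e_sym : symmetric e) (e_irr : irreflexive e) (l_inj : injective l).

Definition later : rel V := fun u w => e u w && (l u < l w)%N.

Lemma later_total u v : e u v -> later u v || later v u.
Proof.
move=> euv; rewrite /later (e_sym v) euv /= -neq_ltn.
by apply: contraTneq euv => /l_inj ->; rewrite e_irr.
Qed.

(** [t u w] is the weight of the vertex of [u] that blocks [w], and [slack u]
    is what remains for the free vertex of [u] in a cluster of weight 1. *)
Variable t : V -> V -> R.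

Definition slack u : R := 1 - \sum_(w | later u w) t u w.

Hypothesis t_ge0 : forall u w, later u w -> 0 <= t u w.
Hypothesis slack_ge0 : forall u, 0 <= slack u.

(** The pair [(u, w)] lies in the cluster of [u].  It blocks [w] when [w] is a
    later neighbour of [u], and is free otherwise; among the free vertices only
    [(u, u)] gets weight, the others being padding that makes the vertex set a
    product. *)
Definition blocking_weight (x : V * V) : R :=
  if later x.1 x.2 then t x.1 x.2 else if x.2 == x.1 then slack x.1 else 0.

Definition blocks (x y : V * V) : bool :=
  [&& later x.1 x.2, x.2 == y.1 & ~~ later y.1 y.2].

(** Vertices of weight 0 carry no edge: this does not affect the densities, and
    it removes the free vertex of a cluster without slack. *)
Definition blocking_adj : rel (V * V) := fun x y =>
  [&& e x.1 y.1, 0 < blocking_weight x, 0 < blocking_weight y,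
      ~~ blocks x y & ~~ blocks y x].

Lemma blocking_nonempty v : exists x : V * V, x.1 = v.
Proof. by exists (v, v). Qed.

Lemma blocking_adj_sym : symmetric blocking_adj.
Proof.
move=> x y; rewrite /blocking_adj e_sym; congr (_ && _); rewrite andbCA.
by do 2!congr (_ && _); rewrite andbC.
Qed.

Lemma blocking_adj_cluster x y : blocking_adj x y -> e x.1 y.1.
Proof. by case/and5P. Qed.

Lemma blocking_weight_ge0 x : 0 <= blocking_weight x.
Proof.
rewrite /blocking_weight; case: ifP => [/t_ge0 //|_].
by case: ifP.
Qed.

Lemma cluster_sum (F : V * V -> R) u (P : pred (V * V)) :
  \sum_(x : V * V | (x.1 == u) && P x) F x = \sum_(w | P (u, w)) F (u, w).
Proof.
rewrite (reindex_onto (fun w => (u, w)) snd) /=.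
  by apply: eq_bigl => w; rewrite !eqxx andbT.
by case=> a b /= /andP[/eqP-> _].
Qed.

Lemma unblocked_weight u :
  \sum_(w | ~~ later u w) blocking_weight (u, w) = slack u.
Proof.
have Nuu : ~~ later u u by rewrite /later e_irr.
rewrite (bigD1 u) //= big1 => [|w /andP[Nw wu]]; last first.
  by rewrite /blocking_weight (negPf Nw) /= (negPf wu).
by rewrite /blocking_weight (negPf Nuu) /= eqxx addr0.
Qed.

Lemma blocking_weight_cluster u :
  \sum_(x : V * V | x.1 == u) blocking_weight x = 1.
Proof.
under eq_bigl do rewrite -[_ == _]andbT.
rewrite (cluster_sum _ _ xpredT) (bigID (later u)) /= unblocked_weight.
rewrite (eq_bigr (t u)) => [|w uw]; first by rewrite /slack addrC subrK.
by rewrite /blocking_weight [later _ _]uw.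
Qed.

Definition blocking_blowup : blowup R e :=
  Blowup blocking_nonempty blocking_adj_sym blocking_adj_cluster
    blocking_weight_ge0 blocking_weight_cluster.

(** A transversal uses free vertices only: the blocking vertex of largest label
    would block the free vertex chosen for its target.  But a free vertex of [v]
    has weight 0, hence no edge, whereas [v] has a neighbour [w]. *)
Lemma blocking_no_transversal v w :
  later v w -> slack v = 0 -> ~ has_transversal e blocking_blowup.
Proof.
move=> vw v0 [phi [phi_cl phi_adj]].
have {}phi_cl u : (phi u).1 = u by apply: phi_cl.
have unblocked u : ~~ later u (phi u).2.
  have [m] := ubnP (\max_u l u - l u); elim: m u => // m IHm u le_um.
  apply/negP => uw; set w' := (phi u).2 in uw.
  have /andP[euw ltuw] := uw.
  have Nw : ~~ later w' (phi w').2.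
    apply: IHm; have := leq_bigmax (F := l) w'; move: ltuw le_um.
    rewrite ltnS => lt1 le1 le2; apply: leq_trans le1.
    by apply: ltn_sub2l => //; apply: leq_trans lt1 le2.
  have := phi_adj _ _ euw => /and5P[_ _ _ + _].
  by rewrite /blocks !phi_cl uw Nw eqxx.
have /andP[evw _] := vw.
have /and5P[_ + _ _ _] := phi_adj _ _ evw.
rewrite /blocking_weight phi_cl (negPf (unblocked v)) v0.
by case: ifP; rewrite ltxx.
Qed.

(** Between the clusters of [u] and [v], with [v] later, the only missing pairs
    of positive weight join the vertex [(u, v)] to the free vertex of [v]. *)
Lemma blocking_density u v :
  later u v -> 1 - t u v * slack v <= density blocking_blowup u v.
Proof.
move=> uv; rewrite lerBlDr -(density_complement blocking_blowup u v) lerD2l.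
pose W := blocking_weight.
have Wuv : W (u, v) = t u v by rewrite /W /blocking_weight /= uv.
have -> : t u v * slack v =
    \sum_(x : V * V | x.1 == u) \sum_(y : V * V | y.1 == v)
       (if (x.2 == v) && ~~ later v y.2 then W x * W y else 0).
  under eq_bigl do rewrite -[_ == _]andbT.
  rewrite (cluster_sum _ _ xpredT) (bigD1 v) //= [X in _ + X]big1 => [|b bv].
    rewrite addr0; under eq_bigl do rewrite -[_ == _]andbT.
    rewrite (cluster_sum _ _ xpredT) /= -unblocked_weight mulr_sumr.
    rewrite [LHS]big_mkcond; apply: eq_bigr => c _ /=; rewrite eqxx /=.
    by rewrite Wuv.
  by apply: big1 => y _; rewrite (negPf bv).
apply: ler_sum => x /= /eqP xu; rewrite [leLHS]big_mkcondr /=.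
apply: ler_sum => y /= /eqP yv.
have W0 z : 0 <= W z by apply: blocking_weight_ge0.
case: ifP => [Nadj|_]; last by case: ifP => // _; rewrite mulr_ge0.
case: ifP => // Nblock; rewrite -/(W x) -/(W y).
have [->|Wx] := eqVneq (W x) 0; first by rewrite mul0r.
have [->|Wy] := eqVneq (W y) 0; first by rewrite mulr0.
have /andP[euv ltuv] := uv; move: Nadj.
rewrite /= /blocking_adj /blocks xu yv euv -!/(W _) !lt_def !W0 Wx Wy /=.
case: (x.2 =P v) Nblock => [->|_ _] /=.
  move/negbFE=> lvy; rewrite lvy !andbF /= negbK => /andP[/eqP yu _].
  by move: lvy; rewrite yu /later (ltnNge (l v)) (ltnW ltuv) andbF.
rewrite andbF /= negbK => /and3P[/andP[_ lt1] /eqP yu _].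
by rewrite yu ltnNge ltnW in lt1.
Qed.
End Construction.

(** * The survival weights *)

Section Recursion.
Variables (R : realType) (V : finType) (e : rel V) (l : V -> nat).
Variable gamma : V -> V -> R.
Hypotheses (e_sym : symmetric e) (e_irr : irreflexive e) (l_inj : injective l).
Hypothesis gamma_sym : forall u v, e u v -> gamma u v = gamma v u.
Hypothesis gamma_le1 : forall u v, e u v -> gamma u v <= 1.
Local Notation later := (later e l).

(** The equation determines [g] whatever signs occur, as division is total; its
    value at [u] is meaningful as long as [g] is positive at larger labels. *)
Lemma survival_exists :
  exists g : V -> R,
    forall u, g u = 1 - \sum_(w | later u w) (1 - gamma u w) / g w.
Proof.
pose F g u : R := 1 - \sum_(w | later u w) (1 - gamma u w) / g w.
apply: (@ranked_recursion V R (fun u => (\max_v l v - l u)%N) F 0) => g h u gh.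
congr (_ - _); apply: eq_bigr => w /andP[_ ltuw]; rewrite gh //.
by apply: ltn_sub2l => //; apply: leq_trans ltuw (leq_bigmax w).
Qed.

Lemma blowup_of_nonpositive (g : V -> R) v :
  (forall u, g u = 1 - \sum_(w | later u w) (1 - gamma u w) / g w) ->
  g v <= 0 ->
  exists G : blowup R e, ~ has_transversal e G /\ has_densities e gamma G.
Proof.
move=> gE gv.
have [{gv}v gv vmax] := arg_maxnP (P := [pred u | g u <= 0]) l gv.
have g_gt0 w : (l v < l w)%N -> 0 < g w.
  by rewrite ltNge; apply: contraL => /vmax; rewrite -leqNgt.
pose S := 1 - g v; have S1 : 1 <= S by rewrite /S; move: gv => /= gv; lra.
have S0 : 0 < S by lra.
(* The weights are scaled by [c]: at [v] so that they fill the cluster, and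
   below [v] to 0, since [g] has no reason to be nonnegative there. *)
pose c u : R := if (l u < l v)%N then 0 else if u == v then S^-1 else 1.
pose t u w : R := c u * ((1 - gamma u w) / g w).
have c_ge0 u : 0 <= c u.
  by rewrite /c; case: ifP => // _; case: ifP; rewrite // invr_ge0 ltW.
have c_le1 u : c u <= 1.
  by rewrite /c; case: ifP => // _; case: ifP => // _; rewrite invf_le1.
have t_ge0 u w : later u w -> 0 <= t u w.
  case/andP=> euw ltuw; rewrite /t /c; case: (ltnP (l u) (l v)) => [|leuv].
    by rewrite mul0r.
  rewrite mulr_ge0 ?c_ge0 // ?divr_ge0 // ?subr_ge0 ?gamma_le1 //.
    by case: ifP; rewrite // invr_ge0 ltW.
  by apply/ltW/g_gt0; apply: leq_ltn_trans ltuw.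
have slackE u : slack e l t u = 1 - c u * (1 - g u).
  by rewrite /slack -mulr_sumr (gE u) subKr.
have slack_v : slack e l t v = 0.
  by rewrite slackE /c ltnn eqxx -/S mulVf ?subrr // gt_eqF.
have slack_gt u : (l v < l u)%N -> slack e l t u = g u.
  move=> ltvu; rewrite slackE /c ltnNge (ltnW ltvu) /=.
  case: eqP ltvu => [->|_ _]; first by rewrite ltnn.
  by rewrite mul1r subKr.
have slack_ge0 u : 0 <= slack e l t u.
  have [ltuv|ltvu|/l_inj->] := ltngtP (l u) (l v); last by rewrite slack_v.
    by rewrite slackE /c ltuv mul0r subr0.
  by rewrite slack_gt // ltW // g_gt0.
exists (blocking_blowup e_sym e_irr t_ge0 slack_ge0); split.
  have [w vw|no_w] := pickP (later v).
    exact: blocking_no_transversal vw slack_v.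
  by move: slack_v; rewrite /slack big_pred0 // subr0 => /eqP; rewrite oner_eq0.
have dens u w : later u w ->
    gamma u w <= density (blocking_blowup e_sym e_irr t_ge0 slack_ge0) u w.
  move=> uw; apply: le_trans (blocking_density _ _ _ _ uw).
  have /andP[euw ltuw] := uw; have gle := gamma_le1 euw.
  rewrite lerBrDr -lerBrDl.
  have [ltuv|levu] := ltnP (l u) (l v).
    by rewrite /t /c ltuv !mul0r subr_ge0.
  have ltvw : (l v < l w)%N by apply: leq_ltn_trans ltuw.
  rewrite slack_gt // /t -mulrA divfK ?gt_eqF ?g_gt0 //.
  by rewrite ler_piMl // subr_ge0.
move=> u w euw; case/orP: (later_total e_sym e_irr l_inj euw); first exact: dens.
by move=> /dens; rewrite density_sym (gamma_sym euw).
Qed.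
End Recursion.

(** * Transversals of the monotone-path tree *)

Section Tree.
Variables (R : realType) (V : finType) (e : rel V) (n : nat) (f : 'I_n.+1 -> V).
Variables (l : V -> nat) (gamma : V -> V -> R).
Hypothesis lf : forall i, l (f i) = i.
Hypothesis gamma_le1 : forall u v, e u v -> gamma u v <= 1.
Local Notation later := (later e l).
Local Notation mpath := (mpath e f).
Local Notation extends := (@mpath_extends V e n f).

Lemma mpath_seq_inj : injective (@mpath_seq V e n f).
Proof. by move=> p q /val_inj/val_inj. Qed.

Lemma extends_size (p q : mpath) :
  extends p q -> size (mpath_seq q) = (size (mpath_seq p)).+1.
Proof. by case/existsP=> i /eqP->; rewrite size_rcons. Qed.

Lemma extends_parent_inj (p p' q : mpath) :
  extends p q -> extends p' q -> p = p'.
Proof.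
case/existsP=> i /eqP qE /existsP[j]; rewrite qE => /eqP/rcons_inj[ppE _].
exact: mpath_seq_inj.
Qed.

Lemma extends_later (p q : mpath) :
  extends p q -> later (mpath_end p) (mpath_end q).
Proof.
case/existsP=> i /eqP qE; rewrite /mpath_end qE last_rcons.
have := valP p; have := valP q; rewrite -/(mpath_seq p) -/(mpath_seq q) qE.
rewrite /monotone_path; case: (mpath_seq p) => [|a s] // /and3P[_ + +] _.
rewrite map_rcons /= !rcons_path !last_map /= /later !lf => /andP[_ ltab].
by case/andP=> _ ->.
Qed.

Lemma extends_end_inj (p q q' : mpath) :
  extends p q -> extends p q' -> mpath_end q = mpath_end q' -> q = q'.
Proof.
have f_inj : injective f by move=> i j /(congr1 l); rewrite !lf => /val_inj.
case/existsP=> i /eqP qE /existsP[j /eqP q'E].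
rewrite /mpath_end qE q'E !last_rcons => /f_inj ij.
by apply: mpath_seq_inj; rewrite qE q'E ij.
Qed.

Variable G : blowup R (@mtree_adj V e n f).

(** [good x] says that the subtree above the cluster of [x] embeds with its root
    at [x].  As the children of a node can be treated independently, this is the
    local condition that each child has a good vertex adjacent to [x]. *)
Lemma extendable_exists :
  exists good : pred (bl_vertex G), forall x, good x =
    [forall q, extends (bl_cluster G x) q ==>
       [exists y, [&& bl_cluster G y == q, bl_adj G x y & good y]]].
Proof.
pose r x := (n.+1 - size (mpath_seq (bl_cluster G x)))%N.
pose F (good : bl_vertex G -> bool) x : bool :=
  [forall q, extends (bl_cluster G x) q ==>
       [exists y, [&& bl_cluster G y == q, bl_adj G x y & good y]]].
apply: (@ranked_recursion _ _ r F true) => g h x gh.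
apply: eq_forallb => q; case xq: (extends _ q) => //=.
apply: eq_existsb => y; case: eqP => //= yq; rewrite gh // /r yq.
rewrite (extends_size xq); apply: ltn_sub2l => //.
by rewrite -(extends_size xq); apply: size_bseq.
Qed.

Variable good : pred (bl_vertex G).
Hypothesis goodE : forall x, good x =
    [forall q, extends (bl_cluster G x) q ==>
       [exists y, [&& bl_cluster G y == q, bl_adj G x y & good y]]].

(** Choose good vertices from short paths to long ones, each adjacent to the
    vertex chosen for the parent.  A path without parent needs any good vertex
    of its cluster, which is why one is required in every cluster. *)
Lemma transversal_of_extendable :
  (forall p, exists x, (bl_cluster G x == p) && good x) -> has_transversal _ G.
Proof.
move=> good_ex.
pose x0 p := xchoose (good_ex p).
pose P (phi : mpath -> bl_vertex G) q y :=
  [&& bl_cluster G y == q, good y &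
      [forall p, extends p q ==> bl_adj G (phi p) y]].
have [phi phiE] : exists phi, forall q, phi q = odflt (x0 q) [pick y | P phi q y].
  apply: (@ranked_recursion _ _ (fun q => size (mpath_seq q))
    (fun phi q => odflt (x0 q) [pick y | P phi q y])) => [|g h q gh].
    exact: x0 (@Sub _ _ _ [bseq ord0] isT).
  congr odflt; apply: eq_pick => y; congr [&& _, _ & _].
  apply: eq_forallb => p; case pq: (extends p q) => //=.
  by rewrite gh // (extends_size pq).
have phiP q : P phi q (phi q).
  have [m] := ubnP (size (mpath_seq q)); elim: m q => // m IHm q le_qm.
  rewrite phiE; case: pickP => [y //|noP].
  suff [y Pqy] : exists y, P phi q y by rewrite noP in Pqy.
  have [p pq|no_p] := pickP (fun p => extends p q); last first.
    have [y /andP[yq good_y]] := good_ex q; exists y; rewrite /P yq good_y /=.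
    by apply/forallP=> p; rewrite no_p.
  have /and3P[/eqP phi_p + _] : P phi p (phi p).
    by apply: IHm; rewrite -ltnS -(extends_size pq).
  rewrite goodE phi_p => /forallP/(_ q); rewrite pq => /existsP[y].
  case/and3P=> yq adj_y good_y; exists y; rewrite /P yq good_y /=.
  apply/forallP=> p'; apply/implyP => p'q.
  by rewrite (extends_parent_inj p'q pq).
exists phi; split=> [q|p q]; first by have /and3P[/eqP] := phiP q.
have adj p' q' : extends p' q' -> bl_adj G (phi p') (phi q').
  by have /and3P[_ _ /forallP/(_ p')/implyP] := phiP q'.
by case/orP=> [|/adj]; [exact: adj|rewrite bl_adj_sym].
Qed.

Variable g : V -> R.
Hypothesis g_gt0 : forall u, 0 < g u.
Hypothesis gE :
  forall u, g u = 1 - \sum_(w | later u w) (1 - gamma u w) / g w.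
Hypothesis G_dens : has_densities (@mtree_adj V e n f) (mtree_weight gamma) G.

(** Every vertex of the cluster of [p] that is not good is bad for some child
    [q], that is, adjacent to no good vertex of [q].  The bad vertices for [q]
    and the good vertices of [q] span no edge, so the former have weight at most
    [(1 - gamma) / g].  Distinct children of [p] end at distinct later
    neighbours of the end of [p], so these bounds add up to at most [1 - g]. *)
Lemma extendable_weight_ge p :
  g (mpath_end p) <= \sum_(x | (bl_cluster G x == p) && good x) bl_weight G x.
Proof.
have [m] := ubnP (n.+1 - size (mpath_seq p)); elim: m p => // m IHm p le_pm.
pose bad q x := [forall y, (bl_cluster G y == q) && good y ==> ~~ bl_adj G x y].
have bad_le q : extends p q ->
    \sum_(x | (bl_cluster G x == p) && bad q x) bl_weight G x
    <= (1 - gamma (mpath_end p) (mpath_end q)) / g (mpath_end q).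
  move=> pq; rewrite ler_pdivlMr //.
  have Gpq : mtree_weight gamma p q <= density G p q.
    by apply: G_dens; rewrite /mtree_adj /= pq.
  apply: le_trans (lerB (lexx 1) Gpq).
  apply: le_trans (independent_weight_le (P := bad q) (Q := good) _); last first.
    move=> x y /forallP/(_ y) + good_y _ yq.
    by rewrite yq eqxx good_y.
  apply: ler_wpM2l; first by apply: sumr_ge0 => x _; apply: bl_weight_ge0.
  apply: IHm; rewrite ltnS in le_pm; apply: leq_trans le_pm.
  rewrite (extends_size pq).
  by apply: ltn_sub2l; rewrite // -(extends_size pq); apply: size_bseq.
rewrite gE lerBlDr -[leLHS](bl_weight_cluster G p) [leLHS](bigID good) /= lerD2l.
apply: le_trans (_ : \sum_(q | extends p q)
   \sum_(x | (bl_cluster G x == p) && bad q x) bl_weight G x <= _).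
  under [leRHS]eq_bigr do rewrite big_mkcondr.
  rewrite exchange_big /= big_mkcondr /=; apply: ler_sum => x /eqP xp.
  have w0 := bl_weight_ge0 x.
  case: ifP => [|_]; last by apply: sumr_ge0 => q _; case: ifP.
  rewrite goodE negb_forall xp => /existsP[q]; rewrite negb_imply => /andP[pq].
  rewrite negb_exists => /forallP no_y.
  rewrite (bigD1 q) //= ifT ?lerDl; first by apply: sumr_ge0 => q' _; case: ifP.
  apply/forallP=> y; have := no_y y; case: eqP => //= _.
  by case: (bl_adj _ _ _); case: (good y).
apply: le_trans (ler_sum _ bad_le) _.
set tau := fun w => (1 - gamma (mpath_end p) w) / g w.
have tau0 w : later (mpath_end p) w -> 0 <= tau w.
  by case/andP=> epw _; rewrite divr_ge0 ?subr_ge0 ?gamma_le1 ?(ltW (g_gt0 w)).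
rewrite (partition_big (@mpath_end V e n f) (later (mpath_end p))) /=; last first.
  by move=> q; apply: extends_later.
apply: ler_sum => w lw.
have [q /andP[pq /eqP qw]|no_q] :=
    pickP (fun q => extends p q && (mpath_end q == w)).
  rewrite (big_pred1 q) => [|q']; first by rewrite qw.
  apply/andP/eqP => [[pq' /eqP q'w]|->]; last by rewrite pq qw.
  by apply: extends_end_inj pq' pq _; rewrite q'w qw.
by rewrite big_pred0 // tau0.
Qed.

Lemma tree_has_transversal : has_transversal _ G.
Proof.
apply: transversal_of_extendable => p; apply/existsP; apply: contraT.
rewrite negb_exists => /forallP no_x.
have := extendable_weight_ge p; rewrite leNgt big_pred0 ?g_gt0 // => x.
by apply: negbTE.
Qed.
End Tree.

Theorem theorem5p3 (R : realType) (V : finType) (e : rel V) (n : nat)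
    (f : 'I_n.+1 -> V) (gamma : V -> V -> R)
    (e_sym : symmetric e) (e_irr : irreflexive e)
    (e_conn : connected_graph e) (f_proper : proper_labeling e f)
    (gamma_sym : forall u v, e u v -> gamma u v = gamma v u)
    (gamma_01 : forall u v, e u v -> 0 <= gamma u v <= 1)
    (not_ensured :
      ~ ensures_factor (@mtree_adj V e n f) (mtree_weight gamma)) :
  exists G : blowup R e, ~ has_transversal e G /\ has_densities e gamma G.
Proof.
have [[f' fK f'K] _] := f_proper.
pose l v : nat := f' v.
have lf i : l (f i) = i by rewrite /l fK.
have l_inj : injective l by move=> u v /val_inj/(can_inj f'K).
have gamma_le1 u v : e u v -> gamma u v <= 1 by case/gamma_01/andP.
have [g gE] := survival_exists e l gamma.
have [v gv|g_gt0] := pickP (fun v => g v <= 0).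
  exact: blowup_of_nonpositive gE gv.
case: not_ensured => G G_dens; have [good goodE] := extendable_exists G.
apply: (tree_has_transversal lf gamma_le1 goodE _ gE G_dens) => u.
by rewrite ltNge g_gt0.
Qed.
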